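(* Let $N\ge 1$ be an integer, let $p\in(0,\frac1N)$, and write $\alpha = Np$. Let $Z_{N,p}$ be a random variable with the Abelian distribution with parameters $N,p$. Then its second moment is $$E(Z_{N,p}^{2})= \frac{C_{N,p}}{p}\left[\frac{1}{1-Np}-1-\sum_{i=1}^{N-1} \frac{(N-1)!}{(N-1-i)!}p^i\right],$$ and its variance is $$V(Z_{N,p})=\frac{C_{N,p}}{p}\left[\frac{1}{1-Np}-1-\sum_{i=1}^{N-1} \frac{(N-1)!}{(N-1-i)!}p^i\right] - \left(\frac{N}{N-(N-1)\alpha}\right)^{2}.$$
   Context: For an integer $N\ge 1$ and $p\in(0,\frac1N)$, the Abelian distribution with parameters $N,p$ is the probability distribution on $\{1,2,\dots,N\}$ given by $$P(Z_{N,p} = b)= C_{N,p}\binom{N-1}{b-1}p^{b-1}(1-bp)^{N-b-1}b^{b-2},\qquad b=1,\dots,N,$$ where $C_{N,p}= \frac{1-Np}{1-(N-1)p}$ is the normalization constant. (It is known that these values sum to $1$.) $E$ denotes expectation and $V$ denotes variance. An empty sum is $0$. *)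

(* Defs.v *)
From HB Require Import structures.
From mathcomp Require Import all_boot all_order all_algebra.
From mathcomp Require Import all_classical all_reals all_analysis.

Set Implicit Arguments.
Unset Strict Implicit.
Unset Printing Implicit Defensive.

Import Order.TTheory GRing.Theory Num.Theory.

Local Open Scope classical_set_scope.
Local Open Scope ring_scope.

Definition abelian_const (R : realType) (N : nat) (p : R) : R :=
  (1 - N%:R * p) / (1 - (N%:R - 1) * p).

(* The last two exponents are integers, not truncated naturals: [N - b - 1] is
   [-1] at [b = N], and [b - 2] is [-1] at [b = 1]. Only meant for
   [1 <= b <= N]. *)
Definition abelian_pmf (R : realType) (N : nat) (p : R) (b : nat) : R :=
  abelian_const N p * 'C(N.-1, b.-1)%:R * p ^+ b.-1
  * (1 - b%:R * p) ^ (N%:Z - b%:Z - 1) * b%:R ^ (b%:Z - 2).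

(* A real-valued [Z] has the Abelian distribution when its law is carried by
   [{1, ..., N}] and has the prescribed masses there. *)
Definition has_abelian_distribution (d : measure_display)
    (T : measurableType d) (R : realType) (P : probability T R)
    (Z : {RV P >-> R}) (N : nat) (p : R) : Prop :=
  distribution P Z [set b%:R | b in [set b : nat | (1 <= b <= N)%N]] = 1%E
  /\ forall b : nat, (1 <= b <= N)%N ->
       distribution P Z [set b%:R] = (abelian_pmf N p b)%:E.

(* Main.v *)
Require Import Defs.
From HB Require Import structures.
From mathcomp Require Import all_boot all_order all_algebra.
From mathcomp Require Import all_classical all_reals all_analysis.
From mathcomp Require Import measurable_realfun ring lra.

Set Implicit Arguments.
Unset Strict Implicit.
Unset Printing Implicit Defensive.

Import Order.TTheory GRing.Theory Num.Theory.

Local Open Scope classical_set_scope.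
Local Open Scope ring_scope.

(** Both moments come down to finite sums over [b = k + 1], [k <= n = N - 1],
    built from [a_k = (k + 1) p] and [w_k = 1 - a_k].  Since
    [a_k ^ k = p ^ k b ^ k], multiplying the mass at [b] by [b] turns it into
    [C * 'C(n, k) * a_k ^ k * w_k ^ (n - k - 1)]: the factor [b ^ (b - 2)] has
    become the [k]-th power that Abel's binomial identity wants.

    Here [a] is an increasing and [w] a decreasing arithmetic progression with
    the same step, so [a_k + w_k] is a constant [s].  Abel's identity
    ([abel_identity]) evaluates the sum of
    ['C(n, k) * a_k ^ k * w_k ^ (n - k - 1)] as [s ^ n / w_n].  To see it, write
    [a_k = s - w_k] and expand the [k]-th power: the coefficient of [s ^ j] is
    an alternating binomial sum of order [n - j] of the polynomial
    [w ^ (n - j - 1)], whose degree is too small for it to survive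
    ([alternating_binomial_sum]) unless [j = n], where only [k = n] contributes
    and leaves [1 / w_n].  With [s = 1] this gives the mean
    [C / (1 - N p)].

    A second factor [b = (1 - w_k) / p] splits the second moment into the mean
    divided by [p], minus [C / p] times the sum of
    ['C(n, k) * a_k ^ k * w_k ^ (n - k)].  The latter is Cauchy's companion sum
    ([cauchy_identity]): peeling [w_k = w_n + (n - k) c], [c] being the step,
    off each term leaves Abel's sum plus [n c] times the same sum of order
    [n - 1], and unrolling this recurrence gives the falling factorials of the
    statement.

    On the probability side, an almost surely finitely valued variable has the
    expectations of a finite sum ([expectation_finite_range]).  This covers the
    second moment, the mean and the total mass, and hence the variance as the
    expectation of [(Z - m) ^ 2]. *)

(** * Abel's and Cauchy's binomial identities *)

Lemma subn_predS (n k : nat) : (k < n)%N -> (n - k = (n.-1 - k).+1)%N.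
Proof. by case: n => // n; rewrite ltnS => le_kn; rewrite subSn. Qed.

Lemma signr_subn (R : pzRingType) (k j : nat) :
  (j <= k)%N -> (-1) ^+ (k - j) = (-1) ^+ k * (-1) ^+ j :> R.
Proof.
by move=> le_jk; rewrite -{2}(subnK le_jk) exprD -mulrA -expr2 sqrr_sign mulr1.
Qed.

(** The [n]-th finite difference kills polynomials of degree below [n].  The
    induction peels one factor [u - m c] at a time: the part [u] lowers the
    degree, and the part [m c], through [m 'C(n, m) = n 'C(n - 1, m - 1)],
    lowers the degree and the order together. *)
Lemma alternating_binomial_sum (R : comNzRingType) (n e : nat) (u c : R) :
  (e < n)%N ->
  \sum_(m < n.+1) 'C(n, m)%:R * (-1) ^+ m * (u - m%:R * c) ^+ e = 0.
Proof.
elim: e n u => [|e IHe] [|n] u //; rewrite ltnS => lt_en.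
  have := exprBn (1 : R) 1 n.+1; rewrite subrr exprS mul0r => zero.
  rewrite [RHS]zero; apply: eq_bigr => m _.
  by rewrite !expr1n expr0 -[RHS]mulr_natl !mulr1.
transitivity
  (u * \sum_(m < n.+2) 'C(n.+1, m)%:R * (-1) ^+ m * (u - m%:R * c) ^+ e
   + n.+1%:R * c
     * \sum_(m < n.+1) 'C(n, m)%:R * (-1) ^+ m * ((u - c) - m%:R * c) ^+ e).
  have -> : n.+1%:R * c
      * \sum_(m < n.+1) 'C(n, m)%:R * (-1) ^+ m * ((u - c) - m%:R * c) ^+ e
    = - \sum_(m < n.+2) m%:R * c
          * ('C(n.+1, m)%:R * (-1) ^+ m * (u - m%:R * c) ^+ e).
    rewrite [in RHS]big_ord_recl /= !mul0r add0r mulr_sumr -sumrN.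
    apply: eq_bigr => m _; rewrite /bump /= add1n.
    have absorb : n.+1%:R * 'C(n, m)%:R = m.+1%:R * 'C(n.+1, m.+1)%:R :> R.
      by rewrite -!natrM -mul_bin_diag.
    have -> : u - c - m%:R * c = u - m.+1%:R * c by rewrite -natr1; ring.
    transitivity (n.+1%:R * 'C(n, m)%:R
                  * (c * (-1) ^+ m * (u - m.+1%:R * c) ^+ e)); first by ring.
    by rewrite absorb exprS; ring.
  rewrite mulr_sumr -sumrB; apply: eq_bigr => m _.
  by rewrite exprS; ring.
by rewrite (IHe n.+1) ?(IHe n) ?mulr0 ?addr0 // ltnW.
Qed.

Lemma bin_trinomial (n k j : nat) : (j <= k)%N -> (k <= n)%N ->
  ('C(n, k) * 'C(k, j) = 'C(n, j) * 'C(n - j, k - j))%N.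
Proof.
move=> le_jk le_kn.
have le_jn := leq_trans le_jk le_kn.
apply/eqP.
rewrite -(@eqn_pmul2r (j`! * (k - j)`! * (n - k)`!)) ?muln_gt0 ?fact_gt0 //.
have E1 := bin_fact le_jk; have E2 := bin_fact le_kn; have E3 := bin_fact le_jn.
have E4 : ('C(n - j, k - j) * ((k - j)`! * (n - k)`!) = (n - j)`!)%N.
  by rewrite -(bin_fact (leq_sub2r j le_kn)) subnBA // subnK.
apply/eqP; transitivity n`!.
  by rewrite -E2 -E1; ring.
by rewrite -E3 -E4; ring.
Qed.

(** Abel's identity, with the quotient of [(x + y) ^ n] by [y - n c] multiplied
    out: the term [k = n], whose exponent of [y - k c] would be [-1], stands
    apart and no division is left. *)
Lemma abel_identity (R : comNzRingType) (n : nat) (x y c : R) :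
  (\sum_(k < n)
     'C(n, k)%:R * (x + k%:R * c) ^+ k * (y - k%:R * c) ^+ (n.-1 - k))
    * (y - n%:R * c) + (x + n%:R * c) ^+ n = (x + y) ^+ n.
Proof.
set s := x + y; pose w (k : nat) := y - k%:R * c.
have aE k : x + k%:R * c = s - w k by rewrite /w /s; ring.
have expand (k : 'I_n) :
    'C(n, k)%:R * (x + k%:R * c) ^+ k * (y - k%:R * c) ^+ (n.-1 - k)
  = \sum_(j < n) s ^+ j * ('C(n, k) * 'C(k, j))%:R * (-1) ^+ (k - j)
                   * w k ^+ (n.-1 - j).
  rewrite -/(w k) aE -opprB exprNn [(w k - s) ^+ k]exprBn.
  rewrite (big_ord_widen_cond n xpredT (fun i =>
    (-1) ^+ i * w k ^+ (k - i) * s ^+ i *+ 'C(k, i))) //.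
  rewrite !(mulr_sumr, mulr_suml) big_mkcond /=; apply: eq_bigr => j _.
  rewrite ltnS; case: leqP => [le_jk|lt_kj]; last first.
    by rewrite (bin_small lt_kj) // muln0 mulr0 !mul0r.
  have -> : (n.-1 - j = (k - j) + (n.-1 - k))%N.
    have le_kn : (k <= n.-1)%N by rewrite -ltnS (ltn_predK (ltn_ord k)).
    by rewrite addnC addnBA // subnK.
  by rewrite exprD signr_subn // natrM -mulr_natl; ring.
have inner (j : 'I_n) :
    \sum_(k < n) s ^+ j * ('C(n, k) * 'C(k, j))%:R * (-1) ^+ (k - j)
                   * w k ^+ (n.-1 - j)
  = - (s ^+ j * 'C(n, j)%:R * (-1) ^+ (n - j) * w n ^+ (n.-1 - j)).
  apply/eqP; rewrite -addr_eq0; apply/eqP.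
  have lt_jn := ltn_ord j.
  (* Adding the term [k = n] completes the alternating sum, which vanishes. *)
  pose F (k : nat) := s ^+ j * ('C(n, k) * 'C(k, j))%:R * (-1) ^+ (k - j)
                   * w k ^+ (n.-1 - j).
  transitivity (\sum_(0 <= k < n.+1) F k).
    rewrite big_mkord big_ord_recr /=; congr (_ + _).
    by rewrite /F binn mul1n.
  rewrite (big_cat_nat (n := j)) //=; last exact: ltnW (ltnW _).
  rewrite big_nat big1 ?add0r => [|k /andP[_ lt_kj]]; last first.
    by rewrite /F (bin_small lt_kj) // muln0 mulr0 !mul0r.
  rewrite -{1}[nat_of_ord j]add0n big_addn subSn ?(ltnW lt_jn) // big_mkord.
  have := @alternating_binomial_sum R (n - j) (n.-1 - j) (w j) c.
  have -> : (n.-1 - j < n - j)%N by rewrite (subn_predS lt_jn).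
  move=> /(_ isT) zero.
  rewrite -[RHS](mulr0 (s ^+ j * 'C(n, j)%:R)) -[in RHS]zero mulr_sumr.
  apply: eq_bigr => m _; rewrite /F addnK.
  rewrite bin_trinomial ?leq_addl //; last first.
    by rewrite addnC -leq_subRL ?(ltnW lt_jn) // -ltnS ltn_ord.
  have -> : w (m + j)%N = w j - m%:R * c by rewrite /w natrD; ring.
  by rewrite addnK natrM; ring.
rewrite (eq_bigr _ (fun k _ => expand k)) exchange_big /=.
rewrite (eq_bigr _ (fun j _ => inner j)) aE -/(w n) mulr_suml.
(* Expanded around [s] as well, [(s - w_n) ^ n] supplies [s ^ n] and cancels
   every other term. *)
rewrite -[s - w n]opprB exprNn exprBn big_ord_recr /= mulrDr subnn expr0 mulr1.
rewrite binn mulr1n mulrA -expr2 sqrr_sign mul1r addrA mulr_sumr.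
rewrite -big_split /=.
rewrite big1 ?add0r // => j _.
rewrite (signr_subn R (ltnW (ltn_ord j))) (subn_predS (ltn_ord j)).
by rewrite -[_ *+ 'C(n, j)]mulr_natl exprS; ring.
Qed.

(** The sum starts from the same terms as Abel's with one more power of
    [y - k c]; splitting that power as [(y - n c) + (n - k) c] and absorbing
    [n - k] into the binomial coefficient gives
    [S_n = (x + y) ^ n + n c S_(n-1)]. *)
Lemma cauchy_identity (R : comNzRingType) (n : nat) (x y c : R) :
  \sum_(k < n.+1) 'C(n, k)%:R * (x + k%:R * c) ^+ k * (y - k%:R * c) ^+ (n - k)
  = \sum_(i < n.+1) (n ^_ i)%:R * c ^+ i * (x + y) ^+ (n - i).
Proof.
elim: n => [|n IHn]; first by rewrite !big_ord1 /= !expr0 !mulr1.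
rewrite [RHS]big_ord_recl /= ffactn0 subn0 expr0 !mul1r.
transitivity ((x + y) ^+ n.+1 + n.+1%:R * c *
    \sum_(i < n.+1) (n ^_ i)%:R * c ^+ i * (x + y) ^+ (n - i)); last first.
  rewrite mulr_sumr; congr (_ + _); apply: eq_bigr => i _.
  by rewrite /bump /= add1n ffactSS natrM exprS subSS; ring.
rewrite -IHn -(abel_identity n.+1 x y c) big_ord_recr /= subnn binn expr0.
rewrite mulr1 mul1r.
rewrite addrAC; congr (_ + _).
rewrite mulr_sumr mulr_suml -big_split /=; apply: eq_bigr => k _.
have le_kn : (k <= n)%N by rewrite -ltnS.
have absorb : (n.+1%:R - k%:R) * 'C(n.+1, k)%:R = n.+1%:R * 'C(n, k)%:R :> R.
  by rewrite -natrB ?(leqW le_kn) // -!natrM -mul_bin_down.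
rewrite subSn // exprS.
set A := (x + _) ^+ k; set B := (y - k%:R * c) ^+ (n - k).
transitivity ('C(n.+1, k)%:R * A * B * (y - n.+1%:R * c)
              + (n.+1%:R - k%:R) * 'C(n.+1, k)%:R * (c * A * B)).
  by ring.
by rewrite absorb; ring.
Qed.

(** * Expectations under a finitely supported law *)

(** Off a null set, [f \o Z] is the linear combination of the indicators of the
    events [Z = r] with coefficients [f r]. *)
Lemma expectation_finite_range (d : measure_display) (T : measurableType d)
    (R : realType) (P : probability T R) (Z : {RV P >-> R}) (s : seq R)
    (f : R -> R) :
  uniq s -> distribution P Z [set` s] = 1%E -> measurable_fun setT f ->
  ('E_P[f \o Z] = \sum_(r <- s) (f r)%:E * distribution P Z [set r])%E.
Proof.
move=> us Ps mf.
have mZ r : measurable (Z @^-1` [set r]).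
  by rewrite -[X in measurable X]setTI; exact: measurable_funP.
pose g w : \bar R := (\sum_(r <- s) (f r)%:E * (\1_(Z @^-1` [set r]) w)%:E)%E.
have intg r : P.-integrable setT
    (fun w => ((f r)%:E * (\1_(Z @^-1` [set r]) w)%:E)%E).
  by apply: integrableZl => //; exact: integrable_indic.
transitivity (\int[P]_w g w)%E; last first.
  rewrite /g integral_sum //; apply: eq_bigr => r _.
  rewrite integralZl //; last exact: integrable_indic.
  by rewrite integral_indic // setIT.
rewrite unlock; apply: ae_eq_integral => //.
- by apply/measurable_EFinP; apply: measurableT_comp.
- have /integrableP[] // : P.-integrable setT g by exact: integrable_sum.
have ms : measurable (Z @^-1` [set` s]).
  rewrite -[X in measurable X]setTI; apply: measurable_funP => //.
  apply: countable_measurable => [r|]; first exact: measurable_set1.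
  exact/finite_set_countable/finite_seq.
exists (~` (Z @^-1` [set` s])); split.
- exact: measurableC.
- transitivity (1 - distribution P Z [set` s])%E; first exact: probability_setC.
  by rewrite Ps subee.
move=> w /= nfg sZ; apply: nfg => _.
rewrite /g (bigD1_seq (Z w)) //= indicE mem_set // mule1 big1 ?adde0 // => r rZ.
by rewrite indicE memNset ?mule0 //= => Zr; move: rZ; rewrite -Zr eqxx.
Qed.

(** * Moments of the Abelian masses *)

Section AbelianMoments.
Variables (R : realType) (n : nat) (p : R).
Hypotheses (p_gt0 : 0 < p) (np_lt1 : n.+1%:R * p < 1).

Let C := abelian_const n.+1 p.
Let w (k : nat) : R := 1 - p - k%:R * p.
Let mass (k : nat) : R := k.+1%:R * abelian_pmf n.+1 p k.+1.

Let w_gt0 k : (k <= n)%N -> 0 < w k.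
Proof.
move=> le_kn; have : k%:R * p <= n%:R * p by rewrite ler_pM2r // ler_nat.
by move: np_lt1; rewrite /w -natr1; lra.
Qed.

(** Multiplying the size-biased mass by [w k] makes the exponent [n - k] of
    [w k] a natural number for every [k <= n], including [k = n]. *)
Let mass_mul k : (k <= n)%N ->
  mass k * w k = C * ('C(n, k)%:R * (p + k%:R * p) ^+ k * w k ^+ (n - k)).
Proof.
move=> le_kn; have w0 : w k != 0 by rewrite gt_eqF ?w_gt0.
rewrite /mass /abelian_pmf -/C /=.
have -> : 1 - k.+1%:R * p = w k by rewrite /w -natr1; ring.
have -> : p + k%:R * p = k.+1%:R * p by rewrite -natr1; ring.
(* The integer exponents [N - b - 1] and [b - 2] are one less than the natural
   [n - k] and [k]; this covers their value [-1] at the two ends. *)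
have wE : w k ^+ (n - k) = w k ^ (n.+1%:Z - k.+1%:Z - 1) * w k.
  rewrite -{3}[w k]expr1z -expfzDr // subrK [LHS]exprnP; congr (_ ^ _).
  by rewrite -subzn // [n.+1%:Z]intS [k.+1%:Z]intS; ring.
have kE : k.+1%:R ^+ k = k.+1%:R * k.+1%:R ^ (k.+1%:Z - 2) :> R.
  rewrite -{2}[k.+1%:R]expr1z -expfzDr ?pnatr_eq0 // [LHS]exprnP; congr (_ ^ _).
  by rewrite [k.+1%:Z]intS; ring.
by rewrite wE exprMn kE; ring.
Qed.

Lemma abelian_first_moment :
  \sum_(k < n.+1) k.+1%:R * abelian_pmf n.+1 p k.+1 = C / (1 - n.+1%:R * p).
Proof.
have wn0 : w n != 0 by rewrite gt_eqF ?w_gt0.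
have -> : 1 - n.+1%:R * p = w n by rewrite /w -natr1; ring.
apply: (canRL (mulfK wn0)).
have := abel_identity n p (1 - p) p.
rewrite [p + (1 - p)]addrC subrK expr1n => abel.
rewrite big_ord_recr /= mulrDl -[n.+1%:R * _ * _]/(mass n * w n) mass_mul //.
rewrite subnn expr0 mulr1 binn mul1r -[RHS]mulr1 -[X in _ = C * X]abel.
rewrite [RHS]mulrDr [in RHS]mulrA.
congr (_ + _); congr (_ * _); rewrite mulr_sumr; apply: eq_bigr => k _.
have lt_kn := ltn_ord k.
have wk0 : w k != 0 by rewrite gt_eqF ?w_gt0 // ltnW.
apply: (mulIf wk0); rewrite -[LHS]/(mass k * w k) mass_mul ?(ltnW lt_kn) //.
by rewrite -/(w k) subn_predS // exprS; ring.
Qed.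

Lemma abelian_second_moment :
  \sum_(k < n.+1) k.+1%:R ^+ 2 * abelian_pmf n.+1 p k.+1
  = C / p * (1 / (1 - n.+1%:R * p) - 1
             - \sum_(1 <= i < n.+1) n`!%:R / (n - i)`!%:R * p ^+ i).
Proof.
have p0 : p != 0 by rewrite gt_eqF.
have tail : \sum_(1 <= i < n.+1) n`!%:R / (n - i)`!%:R * p ^+ i
    = \sum_(k < n.+1) 'C(n, k)%:R * (p + k%:R * p) ^+ k * w k ^+ (n - k) - 1.
  have -> := cauchy_identity n p (1 - p) p.
  rewrite big_ord_recl ffactn0 !expr0 [p + (1 - p)]addrC subrK expr1n !mulr1.
  rewrite [_ - 1]addrC addKr big_add1 /= big_mkord; apply: eq_bigr => i _.
  rewrite /bump /= add1n expr1n mulr1; congr (_ * _).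
  have le_in : (i.+1 <= n)%N by [].
  by rewrite -(ffact_fact le_in) natrM mulfK // pnatr_eq0 -lt0n fact_gt0.
rewrite tail.
(* [b ^ 2 = b * (1 - w_k) / p]. *)
transitivity ((\sum_(k < n.+1) mass k - \sum_(k < n.+1) mass k * w k) / p).
  rewrite -sumrB mulr_suml; apply: eq_bigr => k _.
  by apply: (canRL (mulfK p0)); rewrite /mass /w -natr1; ring.
rewrite abelian_first_moment.
under [X in _ - X]eq_bigr => k _ do rewrite mass_mul ?leq_ord //.
by rewrite -mulr_sumr; ring.
Qed.

End AbelianMoments.

(** * Second moment and variance of an Abelian variable *)

Lemma abelian_expectation (R : realType) (N : nat) (p : R)
    (d : measure_display) (T : measurableType d) (P : probability T R)
    (Z : {RV P >-> R}) (f : R -> R) :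
  has_abelian_distribution Z N p -> measurable_fun setT f ->
  ('E_P[f \o Z])%E = (\sum_(k < N) f k.+1%:R * abelian_pmf N p k.+1)%:E.
Proof.
case=> total masses mf.
pose s : seq R := [seq b%:R | b <- index_iota 1 N.+1].
rewrite (@expectation_finite_range _ _ _ _ _ s) //.
- rewrite big_map big_add1 /= big_mkord -sumEFin; apply: eq_bigr => k _.
  by rewrite masses // ltn_ord.
- by rewrite map_inj_uniq ?iota_uniq //; exact: mulrIn (oner_neq0 _).
- rewrite -[RHS]total; congr (distribution P Z _); apply/seteqP; split=> r /=.
    by move=> /mapP[b]; rewrite mem_index_iota ltnS => bN ->; exists b.
  by move=> [b bN <-]; apply/mapP; exists b => //; rewrite mem_index_iota ltnS.
Qed.

Theorem theorem2p3 (R : realType) (N : nat) (p alpha : R)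
    (hN : (1 <= N)%N) (hp0 : 0 < p) (hpN : p < 1 / N%:R)
    (halpha : alpha = N%:R * p)
    (d : measure_display) (T : measurableType d) (P : probability T R)
    (Z : {RV P >-> R}) (hZ : has_abelian_distribution Z N p) :
  ('E_P[fun w => (Z w ^+ 2)%R])%E =
    (abelian_const N p / p *
      (1 / (1 - N%:R * p) - 1
       - \sum_(1 <= i < N) (N.-1)`!%:R / (N.-1 - i)`!%:R * p ^+ i))%:E
  /\
  ('V_P[Z])%E =
    (abelian_const N p / p *
      (1 / (1 - N%:R * p) - 1
       - \sum_(1 <= i < N) (N.-1)`!%:R / (N.-1 - i)`!%:R * p ^+ i)
     - (N%:R / (N%:R - (N%:R - 1) * alpha)) ^+ 2)%:E.
Proof.
case: N => // n in hN hpN halpha hZ *; rewrite [n.+1.-1]/=.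
have np_lt1 : n.+1%:R * p < 1 by move: hpN; rewrite ltr_pdivlMr // mulrC.
(* The masses sum to 1 because they carry the law of [Z]. *)
have E0 : \sum_(k < n.+1) abelian_pmf n.+1 p k.+1 = 1.
  have := abelian_expectation hZ (measurable_cst (1 : R)).
  rewrite (expectation_cst P (1 : R)) => -[->].
  by apply: eq_bigr => k _; rewrite mul1r.
have EZ := abelian_expectation hZ (@measurable_id _ _ setT).
have E2 := abelian_expectation hZ (exprn_measurable 2).
rewrite abelian_first_moment // in EZ.
rewrite abelian_second_moment // in E2.
split; first exact: E2.
set m2 := _ / p * _.
set m1 := n.+1%:R / _.
have m1E : abelian_const n.+1 p / (1 - n.+1%:R * p) = m1.
  rewrite /m1 halpha /abelian_const.
  have np0 : 0 <= n%:R * p by rewrite mulr_ge0 // ltW.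
  have n1 : n.+1%:R = n%:R + 1 :> R by rewrite natr1.
  have n0 : 0 <= n%:R :> R by [].
  field.
  by rewrite n1 in np_lt1 *; apply/and3P; split; rewrite gt_eqF //; nra.
(* The variance is the expectation of one more function of [Z], so no square
   integrability has to be established. *)
rewrite /variance unlock.
have -> : fine ('E_P[Z])%E = m1.
  by rewrite -m1E -[LHS]/(fine ('E_P[id \o Z])%E) EZ.
pose f (x : R) := (x - m1) * (x - m1).
have mf : measurable_fun setT f.
  by apply: measurable_funM; apply: measurable_funB.
rewrite -[LHS]/('E_P[f \o Z])%E (abelian_expectation hZ mf); congr (_%:E).
transitivity (\sum_(k < n.+1) (k.+1%:R ^+ 2 * abelian_pmf n.+1 p k.+1
   - (m1 *+ 2) * (k.+1%:R * abelian_pmf n.+1 p k.+1)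
   + m1 ^+ 2 * abelian_pmf n.+1 p k.+1)).
  by apply: eq_bigr => k _; rewrite /f; ring.
rewrite big_split sumrB /= -!mulr_sumr E0 abelian_first_moment // m1E.
by rewrite abelian_second_moment // -/m2; ring.
Qed.
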